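(* Let $G$ be a partial cube with at least three vertices and with $\Theta$-classes $E_1,\ldots,E_d$. Then \begin{align*} \widehat{WW}(G) &= \sum_{i=1}^d\left(n_i^0n_i^1(n_i^1-1)+n_i^1n_i^0(n_i^0-1)\right)\\ &\quad+2\sum_{i=1}^{d-1}\sum_{j=i+1}^d\Big(3n_{ij}^{00}n_{ij}^{01}n_{ij}^{10}+3n_{ij}^{00}n_{ij}^{01}n_{ij}^{11}+3n_{ij}^{00}n_{ij}^{10}n_{ij}^{11}+3n_{ij}^{01}n_{ij}^{10}n_{ij}^{11}\\ &\qquad+n_{ij}^{00}n_{ij}^{11}(n_{ij}^{11}-1)+n_{ij}^{01}n_{ij}^{10}(n_{ij}^{10}-1)+n_{ij}^{10}n_{ij}^{01}(n_{ij}^{01}-1)+n_{ij}^{11}n_{ij}^{00}(n_{ij}^{00}-1)\Big). \end{align*}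
   Context: $d(u,v)$ is the shortest-path distance. $O_3(G)$ is the set of ordered triples $(u,v,w)$ of pairwise distinct vertices of $G$ and $\widehat{WW}(G)=\sum_{(u,v,w)\in O_3(G)}d(u,v)d(u,w)$. A partial cube is a graph isomorphic to an isometric subgraph of a hypercube. Two edges $u_1v_1$, $u_2v_2$ are in relation $\Theta$ if $d(u_1,u_2)+d(v_1,v_2)\ne d(u_1,v_2)+d(v_1,u_2)$; in a partial cube $\Theta$ is an equivalence relation whose classes are the $\Theta$-classes, and for each $\Theta$-class $E_i$ the graph $G-E_i$ has exactly two connected components, denoted $U_i$ and $U_i'$. Set $n_i^0=|V(U_i)|$, $n_i^1=|V(U_i')|$, and for $i\ne j$: $n_{ij}^{00}=|V(U_i)\cap V(U_j)|$, $n_{ij}^{01}=|V(U_i)\cap V(U_j')|$, $n_{ij}^{10}=|V(U_i')\cap V(U_j)|$, $n_{ij}^{11}=|V(U_i')\cap V(U_j')|$. *)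

(* Defs.v *)
From mathcomp Require Import all_boot.

Set Implicit Arguments.
Unset Strict Implicit.
Unset Printing Implicit Defensive.

(* A finite simple graph is a symmetric irreflexive relation e on a finType T;
   its edges are the two-element sets [set u; v] with e u v. *)

Section Graph.
Variables (T : finType) (e : rel T).

(* A shortest walk between two connected vertices has length < #|T|; the value
   is the junk #|T| when u and v are not connected. *)
Definition dist (u v : T) : nat :=
  find (fun n => [exists p : n.-tuple T, path e u p && (last u p == v)])
       (iota 0 #|T|).

Definition connected_graph : Prop := forall u v : T, connect e u v.

Definition edges : {set {set T}} :=
  [set [set p.1; p.2] | p : T * T & e p.1 p.2].

Definition del_edges (F : {set {set T}}) : rel T :=
  [rel u v | e u v && ([set u; v] \notin F)].

Definition components : {set {set T}} :=
  [set [set v | connect e u v] | u : T].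

(* The inequation is invariant under exchanging u1 and v1, or u2 and v2. *)
Definition theta (A B : {set T}) : bool :=
  [exists u1, exists v1, exists u2, exists v2,
    [&& A == [set u1; v1], B == [set u2; v2] &
        dist u1 u2 + dist v1 v2 != dist u1 v2 + dist v1 u2]].

Definition theta_classes : {set {set {set T}}} :=
  equivalence_partition theta edges.

Definition O3 : {set T * T * T} :=
  [set t | uniq [:: t.1.1; t.1.2; t.2]].

Definition WW_hat : nat :=
  \sum_(t in O3) dist t.1.1 t.1.2 * dist t.1.1 t.2.

End Graph.

Definition hypercube (k : nat) : rel {ffun 'I_k -> bool} :=
  [rel x y : {ffun 'I_k -> bool} | #|[set i | x i != y i]| == 1].

(* f is an isomorphism of (T, e) onto the subgraph of the hypercube with vertex
   set f(T) and edge set f(edges e). Connectedness, which being isometric in a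
   hypercube entails, is explicit because dist takes a finite value on
   disconnected pairs. *)
Definition partial_cube (T : finType) (e : rel T) : Prop :=
  connected_graph e /\
  exists (k : nat) (f : T -> {ffun 'I_k -> bool}),
    [/\ injective f,
        {homo f : u v / e u v >-> hypercube u v} &
        forall u v, dist (@hypercube k) (f u) (f v) = dist e u v].

(* Main.v *)
(* In a partial cube the Theta-classes correspond to the hypercube coordinates
   that are not constant on G, and deleting a class separates the vertices by
   the value of its coordinate. Hence d(u,v) counts the classes i with u and v
   on different sides, and WW_hat counts, over all pairs (i,j), the triples
   (u,v,w) with v != w such that i separates u from v and j separates u from w.
   That count depends only on the sizes of the four cells cut out by the classes
   i and j, is symmetric in i and j, and for i = j two of the cells are empty. *)
Require Import Defs.
From mathcomp Require Import all_boot.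
From mathcomp Require Import zify.

Set Implicit Arguments.
Unset Strict Implicit.
Unset Printing Implicit Defensive.

(** * Least-index search and invariants along walks *)

(** [dist] is a [find] over an [iota]; this computes it from a shortest walk whose length stays
    below the search bound. *)
Lemma find_iota_min (P : pred nat) (m N : nat) :
  m < N -> P m -> (forall n, P n -> m <= n) -> find P (iota 0 N) = m.
Proof.
move=> ltmN Pm minm; have hasP : has P (iota 0 N).
  by apply/hasP; exists m => //; rewrite mem_iota.
apply/eqP; rewrite eqn_leq; apply/andP; split.
  rewrite leqNgt; apply/negP => /(before_find 0).
  by rewrite nth_iota // add0n Pm.
have ltfN : find P (iota 0 N) < N by rewrite -[X in _ < X](size_iota 0) -has_find.
by have := nth_find 0 hasP; rewrite nth_iota // add0n => /minm.
Qed.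

Lemma connect_invariant (T : finType) (S : Type) (r : rel T) (g : T -> S) :
  (forall a b, r a b -> g a = g b) -> forall u v, connect r u v -> g u = g v.
Proof.
move=> rg u v /connectP[p]; elim: p u => [|w p IHp] u /=; first by move=> _ ->.
by case/andP=> /rg -> /IHp/[apply].
Qed.

(** * Hypercube distance is Hamming distance *)

Section Hypercube.
Variable k : nat.
Implicit Types x y z : {ffun 'I_k -> bool}.

Lemma hamming_path_le x (p : seq {ffun 'I_k -> bool}) :
  path (@hypercube k) x p -> #|[set i | x i != last x p i]| <= size p.
Proof.
elim: p x => [|y p IHp] x /=.
  by move=> _; rewrite leqn0 cards_eq0; apply/eqP/setP=> i; rewrite !inE eqxx.
case/andP=> /eqP xy /IHp yp; rewrite -add1n -xy.
apply: (leq_trans _ (leq_add (leqnn _) yp)).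
apply: (leq_trans (subset_leq_card _) (leq_card_setU _ _)).
apply/subsetP=> i; rewrite !inE.
by case: (x i); case: (y i); case: (last y p i).
Qed.

Lemma hamming_path x y :
  exists p : #|[set i | x i != y i]|.-tuple {ffun 'I_k -> bool},
    path (@hypercube k) x p && (last x p == y).
Proof.
move En: #|_| => n; elim: n x En => [|n IHn] x En.
  exists [tuple] => /=; apply/eqP/ffunP=> i; apply/eqP.
  by have /setP/(_ i) := cards0_eq En; rewrite !inE => /negbFE.
have [i xyi] : exists i, i \in [set i | x i != y i].
  by apply/set0Pn; rewrite -card_gt0 En.
(* Correcting the single coordinate [i] gives a neighbour of [x] that is one step closer to [y]. *)
pose z := [ffun j => if j == i then y j else x j].
have En' : #|[set j | z j != y j]| = n.
  rewrite (cardsD1 i) xyi in En; case: En => <-; apply: eq_card => j.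
  by rewrite !inE ffunE; case: (j =P i) => //= _; rewrite eqxx.
have [p /andP[zp lastp]] := IHn z En'.
exists [tuple of z :: p]; rewrite /= zp lastp !andbT; apply/cards1P.
exists i; apply/setP=> j; rewrite !inE ffunE; case: (j =P i) => [->|_].
  by move: xyi; rewrite inE => ->.
by rewrite eqxx.
Qed.

Lemma dist_hypercube x y : dist (@hypercube k) x y = #|[set i | x i != y i]|.
Proof.
apply: find_iota_min.
(* The search bound is the number [2 ^ k] of vertices, which exceeds [k] and hence every Hamming
   distance, so the default value of [dist] does not occur. *)
- rewrite card_ffun card_bool card_ord.
  by apply: leq_ltn_trans (ltn_expl k (ltnSn 1)); rewrite -[X in _ <= X]card_ord max_card.
- by apply/existsP; exact: hamming_path.
- move=> n /existsP[p /andP[xp /eqP <-]].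
  by rewrite (leq_trans (hamming_path_le xp)) // size_tuple.
Qed.

End Hypercube.

(** * Counting separated triples by cell sizes *)

Section Cells.
Variable T : finType.
Implicit Types A B : {set T}.

Lemma sum_cells A B (F : bool -> bool -> nat) :
  \sum_u F (u \in A) (u \in B) =
    #|A :&: B| * F true true + #|A :&: ~: B| * F true false
    + #|~: A :&: B| * F false true + #|~: A :&: ~: B| * F false false.
Proof.
have sum1 (C : {set T}) : #|C| = \sum_u (u \in C).
  by rewrite -sum1_card big_mkcond; apply: eq_bigr => u _; case: (u \in C).
rewrite !sum1 !big_distrl /= -!big_split /=; apply: eq_bigr => u _.
by rewrite !inE; case: (u \in A); case: (u \in B); lia.
Qed.

Definition sep A (u v : T) : bool := (u \in A) != (v \in A).

(** Separation already forces [u] to differ from [v] and from [w], so with [v != w] the counted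
    triples are pairwise distinct. *)
Definition sep_triples A B : nat :=
  \sum_u \sum_v \sum_w ((v != w) * (sep A u v * sep B u w)).

(** For fixed [u], the pairs [(v, w)] without the condition [v != w] are counted by a product of two
    sums; the excess is the diagonal [v = w]. Both counts depend only on the cell of [u], so they
    become polynomials in the four cell sizes. *)
Lemma sep_triplesE A B :
  let a := #|A :&: B| in let b := #|A :&: ~: B| in
  let c := #|~: A :&: B| in let d := #|~: A :&: ~: B| in
  sep_triples A B =
    3 * a * b * c + 3 * a * b * d + 3 * a * c * d + 3 * b * c * d
    + a * d * (d - 1) + b * c * (c - 1) + c * b * (b - 1) + d * a * (a - 1).
Proof.
move=> a b c d.
have all_triples : sep_triples A B + \sum_u \sum_v sep A u v * sep B u v =
    \sum_u (\sum_v sep A u v) * (\sum_w sep B u w).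
  rewrite -big_split; apply: eq_bigr => u _ /=.
  rewrite -big_split big_distrl; apply: eq_bigr => v _ /=.
  rewrite big_distrr [in RHS](bigD1 v) //= addnC; congr (_ + _).
  rewrite (bigD1 v) //= eqxx add0n; apply: eq_bigr => w.
  by rewrite eq_sym => ->; rewrite mul1n.
pose s x y := (x != y :> bool) : nat.
have sumA u : \sum_v sep A u v = a * s (u \in A) true + b * s (u \in A) true
    + c * s (u \in A) false + d * s (u \in A) false.
  exact: (sum_cells A B (fun x _ => s (u \in A) x)).
have sumB u : \sum_v sep B u v = a * s (u \in B) true + b * s (u \in B) false
    + c * s (u \in B) true + d * s (u \in B) false.
  exact: (sum_cells A B (fun _ y => s (u \in B) y)).
have sumAB u : \sum_v sep A u v * sep B u v =
    a * (s (u \in A) true * s (u \in B) true)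
    + b * (s (u \in A) true * s (u \in B) false)
    + c * (s (u \in A) false * s (u \in B) true)
    + d * (s (u \in A) false * s (u \in B) false).
  exact: (sum_cells A B (fun x y => s (u \in A) x * s (u \in B) y)).
move: all_triples.
under eq_bigr => u _ do rewrite sumAB.
under [RHS]eq_bigr => u _ do rewrite sumA sumB.
rewrite (sum_cells A B (fun x y => a * (s x true * s y true)
    + b * (s x true * s y false) + c * (s x false * s y true)
    + d * (s x false * s y false))).
rewrite (sum_cells A B (fun x y =>
  (a * s x true + b * s x true + c * s x false + d * s x false) *
  (a * s y true + b * s y false + c * s y true + d * s y false))).
rewrite -/a -/b -/c -/d /s /=.
(* This identity, valid also for [n = 0], eliminates the truncated subtractions and leaves a
   polynomial identity. *)
have pred_mul m n : m * n * (n - 1) + m * n = m * n * n.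
  by case: n => [|n]; rewrite ?muln0 // subn1 addnC -mulnS.
have := (pred_mul a d, pred_mul b c, pred_mul c b, pred_mul d a).
by case=> -[] -[]; lia.
Qed.

Lemma sep_triplesC A B : sep_triples A B = sep_triples B A.
Proof.
apply: eq_bigr => u _; rewrite exchange_big; apply: eq_bigr => v _.
by apply: eq_bigr => w _; rewrite eq_sym (mulnC (sep A _ _)).
Qed.

Lemma sep_triples_diag A :
  sep_triples A A =
    #|A| * #|~: A| * (#|~: A| - 1) + #|~: A| * #|A| * (#|A| - 1).
Proof.
rewrite sep_triplesE !setIid setICr (setIC _ A) setICr cards0.
by rewrite !(muln0, mul0n, addn0, add0n).
Qed.

Lemma sum_O3_sep (I : finType) (A : I -> {set T}) (D : T -> T -> nat) :
  (forall u v, D u v = \sum_i sep (A i) u v) ->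
  \sum_(t in O3 T) D t.1.1 t.1.2 * D t.1.1 t.2 =
    \sum_i \sum_j sep_triples (A i) (A j).
Proof.
move=> DE; have D0 u : D u u = 0.
  by rewrite DE big1 // => i _; rewrite /sep eqxx.
(* Since [D] vanishes on the diagonal, triples with [u = v] or [u = w] contribute nothing, and only
   [v != w] has to be kept. *)
transitivity (\sum_u \sum_v \sum_w ((v != w) * (D u v * D u w))).
  rewrite pair_big pair_big /= big_mkcond; apply: eq_bigr => -[[u v] w] _ /=.
  rewrite inE /= !inE; case: (v =P w) => [->|_] /=; first by rewrite !andbF.
  case: (u =P v) => [->|_] /=; first by rewrite D0 mul0n muln0.
  by case: (u =P w) => [->|_] /=; rewrite ?D0 ?muln0 ?mul1n.
transitivity (\sum_u \sum_v \sum_w \sum_i \sum_j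
    (v != w) * (sep (A i) u v * sep (A j) u w)).
  apply: eq_bigr => u _; apply: eq_bigr => v _; apply: eq_bigr => w _.
  rewrite !DE big_distrl big_distrr; apply: eq_bigr => i _ /=.
  by rewrite !big_distrr.
under eq_bigr => u _.
  under eq_bigr => v _.
    rewrite exchange_big; under eq_bigr => i _ do rewrite exchange_big.
    over.
  rewrite exchange_big; under eq_bigr => i _ do rewrite exchange_big.
  over.
by rewrite exchange_big; apply: eq_bigr => i _; rewrite exchange_big.
Qed.

End Cells.

Lemma sum_sym_pairs (d : nat) (N : 'I_d -> 'I_d -> nat) :
  (forall i j, N i j = N j i) ->
  \sum_i \sum_j N i j = \sum_i N i i + 2 * \sum_(i < d) \sum_(j < d | i < j) N i j.
Proof.
move=> NC; rewrite mul2n -addnn.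
(* Exchanging the sums in one of the two copies turns it into the part with second index below
   [i]. *)
rewrite [X in _ = _ + (_ + X)](exchange_big_dep xpredT) //= -!big_split /=; apply: eq_bigr => i _.
rewrite (bigD1 i) //= (bigID (fun j : 'I_d => i < j)) /=; congr (_ + (_ + _)).
  by apply: eq_bigl => j; rewrite -val_eqE /=; lia.
rewrite [LHS](eq_bigl (fun j : 'I_d => j < i)); last first.
  by move=> j; rewrite -val_eqE /=; lia.
by apply: eq_bigr => j _; apply: NC.
Qed.

(** * Theta-classes as coordinate directions *)

Section IsometricEmbedding.
Variables (T : finType) (e : rel T) (k : nat) (f : T -> {ffun 'I_k -> bool}).
Hypothesis f_edge : {homo f : u v / e u v >-> hypercube u v}.
Hypothesis f_isometric :
  forall u v, dist (@hypercube k) (f u) (f v) = dist e u v.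

Lemma dist_hamming u v : dist e u v = \sum_i (f u i != f v i).
Proof.
rewrite -f_isometric dist_hypercube -sum1_card big_mkcond.
by apply: eq_bigr => i _; rewrite inE; case: eqP.
Qed.

Lemma edge_direction a b : e a b ->
  exists l, forall i, (f a i != f b i) = (i == l).
Proof.
by move=> /f_edge/cards1P[l /setP fl]; exists l => i; have := fl i; rewrite !inE.
Qed.

(** Edges are unordered sets, so the direction is read off without choosing an order of the end
    vertices. *)
Definition has_direction (i : 'I_k) (A : {set T}) : bool :=
  [exists a in A, exists b in A, f a i != f b i].

Lemma has_directionE i a b : has_direction i [set a; b] = (f a i != f b i).
Proof.
apply/existsP/idP => [[x /andP[]]|fab]; last first.
  exists a; rewrite !inE eqxx; apply/existsP; exists b.
  by rewrite !inE eqxx orbT.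
rewrite !inE => /orP[] /eqP-> /existsP[y /andP[]];
  rewrite !inE => /orP[] /eqP->; rewrite ?eqxx //.
by rewrite eq_sym.
Qed.

(* Only the common direction of the two edges contributes to the difference of
   the two distance sums. *)
Lemma dist_cross_neq i l a b c d :
  (forall j, (f a j != f b j) = (j == i)) ->
  (forall j, (f c j != f d j) = (j == l)) ->
  (dist e a c + dist e b d != dist e a d + dist e b c) = (i == l).
Proof.
move=> fab fcd; rewrite -fcd.
rewrite !dist_hamming -!big_split /= (bigD1 i) //= [X in _ != X](bigD1 i) //=.
set S := (X in _ + X != _); set S' := (X in _ != _ + X).
have <- : S = S'.
  apply: eq_bigr => j /negPf; rewrite -fab => /negbFE/eqP ->.
  exact: addnC.
rewrite eqn_add2r; have := fab i; rewrite eqxx.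
by case: (f a i); case: (f b i); case: (f c i); case: (f d i).
Qed.

Lemma theta_direction i a b B :
  (forall j, (f a j != f b j) = (j == i)) -> B \in edges e ->
  theta e [set a; b] B = has_direction i B.
Proof.
move=> fab /imsetP[[c d]]; rewrite inE /= => /edge_direction[l fcd] ->.
rewrite has_directionE fcd; apply/idP/idP => [|il]; last first.
  apply/existsP; exists a; apply/existsP; exists b.
  apply/existsP; exists c; apply/existsP; exists d.
  by rewrite !eqxx (dist_cross_neq fab fcd).
(* The end vertices supplied by [theta] may come in another order, but directions depend only on the
   edge as a set. *)
case/existsP=> u1 /existsP[v1] /existsP[u2] /existsP[v2] /and3P[/eqP AE /eqP BE].
rewrite (@dist_cross_neq i l) // => j.
  by rewrite -has_directionE -AE has_directionE.
by rewrite -has_directionE -BE has_directionE.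
Qed.

Definition direction_class (i : 'I_k) : {set {set T}} :=
  [set A in edges e | has_direction i A].

(** Edges are related exactly when they share their direction. The witness edge excludes coordinates
    along which no edge runs, whose direction class is empty. *)
Lemma theta_classP (C : {set {set T}}) :
  reflect (exists i a b, [/\ C = direction_class i, e a b & f a i != f b i])
          (C \in theta_classes e).
Proof.
have classE a b i (eab : e a b) (fi : f a i != f b i) :
    [set B in edges e | theta e [set a; b] B] = direction_class i.
  have [l fab] := edge_direction eab.
  have /eqP il : i == l by rewrite -fab.
  apply/setP=> B; rewrite !inE; apply: andb_id2l => /(theta_direction fab) ->.
  by rewrite il.
apply: (iffP imsetP) => [[A] /imsetP[[a b]] | [i [a [b [-> eab fi]]]]].
  rewrite inE /= => eab -> ->; have [l fab] := edge_direction eab.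
  have fl : f a l != f b l by rewrite fab.
  by exists l, a, b; split=> //; apply: classE.
exists [set a; b]; last by rewrite (classE a b i).
by apply/imsetP; exists (a, b); rewrite ?inE.
Qed.

Hypothesis e_conn : connected_graph e.

(** A coordinate preserved by every edge would be constant along a walk from [u] to [v]. *)
Lemma direction_of_separated i u v :
  f u i != f v i -> exists a b, e a b /\ f a i != f b i.
Proof.
move=> fuv; case: (boolP [exists a, exists b, e a b && (f a i != f b i)]).
  by case/existsP=> a /existsP[b /andP[]]; exists a, b.
rewrite negb_exists => /forallP no_edge.
suff fE : f u i = f v i by rewrite fE eqxx in fuv.
apply: (connect_invariant (r := e) (g := fun u => f u i)) => // a b eab.
have := no_edge a; rewrite negb_exists => /forallP/(_ b).
by rewrite eab negbK => /eqP.
Qed.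

(** The conclusions make [c] a bijection from the class indices onto the coordinates that are not
    constant on the graph. *)
Lemma theta_directions (d : nat) (E : 'I_d -> {set {set T}}) :
  injective E -> [set E i | i : 'I_d] = theta_classes e ->
  exists c : 'I_d -> 'I_k,
    [/\ injective c, forall i, E i = direction_class (c i),
        forall i, exists a b, f a (c i) != f b (c i) &
        forall l u v, f u l != f v l -> exists i, c i = l].
Proof.
move=> E_inj E_classes.
have cP i : exists l, (E i == direction_class l)
    && [exists a, exists b, e a b && (f a l != f b l)].
  have /theta_classP[l [a [b [-> eab fl]]]] : E i \in theta_classes e.
    by rewrite -E_classes imset_f.
  exists l; rewrite eqxx; apply/existsP; exists a; apply/existsP; exists b.
  by rewrite eab.
pose c i := xchoose (cP i).
have cE i : E i = direction_class (c i).
  by have /andP[/eqP] := xchooseP (cP i).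
exists c; split=> //.
- by move=> i j cij; apply: E_inj; rewrite !cE cij.
- move=> i; have /andP[_ /existsP[a /existsP[b /andP[_ fab]]]] := xchooseP (cP i).
  by exists a, b.
move=> l u v /direction_of_separated[a [b [eab fl]]].
have : direction_class l \in theta_classes e by apply/theta_classP; exists l, a, b.
(* The edge [[set a; b]] lies in the classes of both [l] and [c i]; as an edge has only one
   direction, the two coordinates agree. *)
rewrite -E_classes => /imsetP[i _]; rewrite cE => /setP/(_ [set a; b]).
have ab_edge : [set a; b] \in edges e by apply/imsetP; exists (a, b); rewrite ?inE.
rewrite !inE ab_edge !has_directionE fl => /esym; rewrite /=.
have [m fab] := edge_direction eab.
by move: fl; rewrite !fab => /eqP-> /eqP <-; exists i.
Qed.

(* Connectedness of the two halves is not needed: no component of G minus the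
   class meets both halves, so two components can only be the halves. *)
Lemma component_halves i (V V' : {set T}) a b :
  f a i != f b i ->
  components (del_edges e (direction_class i)) = [set V; V'] ->
  V' = ~: V /\ forall u v, sep V u v = (f u i != f v i).
Proof.
move=> fab compE; set r := del_edges e (direction_class i).
have r_inv u v : connect r u v -> f u i = f v i.
  apply: (connect_invariant (g := fun u => f u i)) => x y /andP[exy].
  have xy_edge : [set x; y] \in edges e by apply/imsetP; exists (x, y); rewrite ?inE.
  by rewrite inE xy_edge has_directionE negbK => /eqP.
pose comp u := [set v | connect r u v].
have comp_refl u : u \in comp u by rewrite inE.
have compP u : comp u = V \/ comp u = V'.
  by apply/set2P; rewrite -compE imset_f.
(* The components of [a] and [b] differ, so they are [V] and [V'] in some order; exchanging [a] and
   [b] fixes the order. *)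
wlog [Va V'b] : a b fab / comp a = V /\ comp b = V'.
  move=> halves; have neq_comp : comp a != comp b.
    apply: contra fab => /eqP ab; have := comp_refl b.
    by rewrite -ab inE => /r_inv ->.
  case: (compP a) (compP b) => aE [] bE; try by rewrite aE bE eqxx in neq_comp.
    exact: (halves a b).
  by apply: (halves b a); rewrite // eq_sym.
have VE u : (u \in V) = (f u i == f a i).
  apply/idP/eqP => [|fua]; first by rewrite -Va inE => /r_inv.
  (* The component of [u] is [V] or [V']; the latter contains [b], whose coordinate [i] differs from
     that of [u]. *)
  have := comp_refl u; case: (compP u) => -> //.
  by rewrite -V'b inE => /r_inv fbu; rewrite -fua fbu eqxx in fab.
have V'E u : (u \in V') = (f u i == f b i).
  apply/idP/eqP => [|fub]; first by rewrite -V'b inE => /r_inv.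
  have := comp_refl u; case: (compP u) => -> //.
  by rewrite -Va inE => /r_inv fau; rewrite fau fub eqxx in fab.
split=> [|u v].
  apply/setP=> u; rewrite inE VE V'E; move: fab.
  by case: (f a i); case: (f b i); case: (f u i).
by rewrite /sep !VE; case: (f a i); case: (f u i); case: (f v i).
Qed.

End IsometricEmbedding.

(** * The formula for partial cubes *)

Theorem theorem5p2 (T : finType) (e : rel T)
  (e_sym : symmetric e) (e_irr : irreflexive e)
  (e_cube : partial_cube e) (T_ge3 : 3 <= #|T|)
  (d : nat) (E : 'I_d -> {set {set T}})
  (E_inj : injective E) (E_classes : [set E i | i : 'I_d] = theta_classes e)
  (U U' : 'I_d -> {set T})
  (U_neq : forall i, U i != U' i)
  (U_comp : forall i, components (del_edges e (E i)) = [set U i; U' i]) :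
  let n0 i := #|U i| in
  let n1 i := #|U' i| in
  let n00 i j := #|U i :&: U j| in
  let n01 i j := #|U i :&: U' j| in
  let n10 i j := #|U' i :&: U j| in
  let n11 i j := #|U' i :&: U' j| in
  WW_hat e =
    \sum_(i < d) (n0 i * n1 i * (n1 i - 1) + n1 i * n0 i * (n0 i - 1))
    + 2 * \sum_(i < d) \sum_(j < d | i < j)
        (3 * n00 i j * n01 i j * n10 i j
         + 3 * n00 i j * n01 i j * n11 i j
         + 3 * n00 i j * n10 i j * n11 i j
         + 3 * n01 i j * n10 i j * n11 i j
         + n00 i j * n11 i j * (n11 i j - 1)
         + n01 i j * n10 i j * (n10 i j - 1)
         + n10 i j * n01 i j * (n01 i j - 1)
         + n11 i j * n00 i j * (n00 i j - 1)).
Proof.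
case: e_cube => e_conn [k [f [_ f_edge f_isom]]].
have [c [c_inj EE c_sep c_onto]] :=
  theta_directions f_edge f_isom e_conn E_inj E_classes.
have halves i : U' i = ~: U i /\
    forall u v, sep (U i) u v = (f u (c i) != f v (c i)).
  have [a [b fab]] := c_sep i.
  by apply: (component_halves (e := e) fab); rewrite -EE.
have distE u v : dist e u v = \sum_i sep (U i) u v.
  (* Coordinates outside the image of [c] separate no two vertices and contribute zero; the others
     are reindexed by the injective [c]. *)
  rewrite (dist_hamming f_isom) (bigID (mem [set c i | i : 'I_d])) /= addnC.
  rewrite big1 ?add0n => [|l]; last first.
    by apply: contraNeq; rewrite eqb0 => /negPn/c_onto[i <-]; rewrite imset_f.
  rewrite big_imset /=; last by move=> i j _ _; apply: c_inj.
  by apply: eq_bigr => i _; have [_ ->] := halves i.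
move=> n0 n1 n00 n01 n10 n11.
rewrite /WW_hat (sum_O3_sep distE).
rewrite sum_sym_pairs => [|i j]; last exact: sep_triplesC.
congr (_ + 2 * _); apply: eq_bigr => i _.
  by rewrite sep_triples_diag /n0 /n1; have [-> _] := halves i.
apply: eq_bigr => j _; rewrite sep_triplesE /n00 /n01 /n10 /n11.
by have [-> _] := halves i; have [-> _] := halves j.
Qed.
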